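(* For real $b$ and nonnegative integers $n$ let $$H_n(b,x)=\det\left(\binom{x+i+j}{2j}+b\binom{x+i+j}{2j+1}\right)_{i,j=0}^{n-1}$$ (a polynomial in $x$, $H_0(b,x)=1$). Then for every $n\ge0$, $$V_n(b,x):=2^nH_n\left(b,\frac{2x-1}{2}\right)=\det\left(\binom{x+i+j}{2j}\frac{2x+2i}{x+i+j}+b\binom{x+i+j}{2j+1}\frac{2x+2i-1}{x+i+j}\right)_{i,j=0}^{n-1},$$ where each matrix entry is understood as the polynomial in $x$ obtained after cancelling the factor $x+i+j$ (for $j=0$ the entry is $2+b(2x+2i-1)$).
   Context: For a polynomial variable $y$ and integer $m\ge0$, $\binom{y}{m}=\frac{y(y-1)\cdots(y-m+1)}{m!}$. The determinant of a $0\times0$ matrix is $1$. *)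

(* Defs.v *)
From mathcomp Require Import all_boot all_order all_algebra.
From mathcomp Require Import reals.

Set Implicit Arguments.
Unset Strict Implicit.
Unset Printing Implicit Defensive.

Import GRing.Theory Num.Theory.
Local Open Scope ring_scope.

Definition binomp (R : realType) (y : {poly R}) (m : nat) : {poly R} :=
  (m`!%:R : R)^-1 *: \prod_(k < m) (y - k%:R).

Definition H (R : realType) (n : nat) (b : R) : {poly R} :=
  \det (\matrix_(i < n, j < n)
    (binomp ('X + i%:R + j%:R) (2 * j)%N +
     b *: binomp ('X + i%:R + j%:R) (2 * j + 1)%N)).

Definition V (R : realType) (n : nat) (b : R) : {poly R} :=
  2 ^+ n * (H n b \Po (2^-1 *: (2 * 'X - 1))).

(* The two fractions of an entry: %/ is Euclidean division in {poly R}; it is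
   exact here, see Vnum_even_dvd and Vnum_odd_dvd. *)
Definition Vnum_even (R : realType) (i j : nat) : {poly R} :=
  binomp ('X + i%:R + j%:R) (2 * j)%N * (2 * 'X + 2 * i%:R).

Definition Vnum_odd (R : realType) (i j : nat) : {poly R} :=
  binomp ('X + i%:R + j%:R) (2 * j + 1)%N * (2 * 'X + 2 * i%:R - 1).

Definition Ventry (R : realType) (b : R) (i j : nat) : {poly R} :=
  Vnum_even R i j %/ ('X + i%:R + j%:R) +
  b *: (Vnum_odd R i j %/ ('X + i%:R + j%:R)).

Lemma H0 (R : realType) (b : R) : H 0 b = 1.
Proof. by rewrite /H det_mx00. Qed.

Lemma dvdp_binomp (R : realType) (y : {poly R}) m : y %| binomp y m.+1.
Proof.
rewrite /binomp big_ord_recl subr0 -mul_polyC mulrCA.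
exact: dvdp_mulIl.
Qed.

Lemma Vnum_even_dvd (R : realType) i j : ('X + i%:R + j%:R : {poly R}) %| Vnum_even R i j.
Proof.
rewrite /Vnum_even; case: j => [|j].
  by rewrite addr0 -mulrDr; apply/dvdp_mull/dvdp_mull.
by rewrite mulnS; apply/dvdp_mulr/dvdp_binomp.
Qed.

Lemma Vnum_odd_dvd (R : realType) i j : ('X + i%:R + j%:R : {poly R}) %| Vnum_odd R i j.
Proof. by rewrite /Vnum_odd addn1; apply/dvdp_mulr/dvdp_binomp. Qed.

Lemma Ventry0 (R : realType) (b : R) i : Ventry b i 0 = 2 + b *: (2 * 'X + 2 * i%:R - 1).
Proof.
have nz : 'X + i%:R != 0 :> {poly R}.
  by rewrite -polyC_natr -[i%:R]opprK polyCN polyXsubC_eq0.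
rewrite /Ventry /Vnum_even /Vnum_odd /binomp !addr0 !muln0 add0n.
rewrite big_ord0 big_ord1 fact0 factS fact0 muln1 invr1 !scale1r mul1r subr0.
by rewrite -mulrDr mulpK // mulrC mulpK.
Qed.

(* Main.v *)
Require Import Defs.
From HB Require Import structures.
From mathcomp Require Import all_boot all_order all_algebra.
From mathcomp Require Import reals ring.

Import GRing.Theory Num.Theory.
Local Open Scope ring_scope.

(** Put [h_j(x) = C(x+j, 2j) + b C(x+j, 2j+1)], so that [H_n] is the
    determinant of the [h_j(x+i)], and let [T f(x) = f(x+1/2) + f(x-1/2)].  The
    entries of the right-hand determinant are [T h_j] evaluated at [x+i-1/2].
    Now [T^2 = 4 + delta^2] for the central difference [delta], and
    [delta^2 h_j = h_{j-1}].  Hence, if [c] is the power series with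
    [c^2 = 4 + t] and [c_0 = 2], then [T h_j = \sum_k c_k h_{j-k}]: the two
    matrices differ by an upper triangular factor with diagonal entries [2]. *)

Section Binomp.
Variable R : realType.
Implicit Types y q : {poly R}.

Lemma binomp_comp y q m : binomp y m \Po q = binomp (y \Po q) m.
Proof.
rewrite /binomp comp_polyZ rmorph_prod; congr (_ *: _); apply: eq_bigr => k _.
by rewrite rmorphB rmorph_nat.
Qed.

Lemma binomp0 y : binomp y 0 = 1.
Proof. by rewrite /binomp big_ord0 fact0 invr1 scale1r. Qed.

(** Up to [m!], both sides are the product of the [y - k] for [k <= m], with the first or the last
    factor split off. *)
Lemma mul_binomp_pred y m : y * binomp (y - 1) m = binomp y m * (y - m%:R).
Proof.
rewrite /binomp -scalerAr -scalerAl; congr (_ *: _).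
transitivity (\prod_(k < m.+1) (y - k%:R)); last by rewrite big_ord_recr.
rewrite big_ord_recl subr0.
by congr (_ * _); apply: eq_bigr => k _; rewrite /= -addrA -opprD -natr1 [1 + _]addrC.
Qed.

Lemma binompS y m : (m.+1%:R : {poly R}) * binomp y m.+1 = binomp y m * (y - m%:R).
Proof.
have e : m.+1%:R * (m.+1)`!%:R^-1 = m`!%:R^-1 :> R.
  by rewrite factS natrM invfM mulrA divff ?pnatr_eq0 // mul1r.
by rewrite /binomp big_ord_recr /= -polyC_natr mul_polyC scalerA e scalerAl.
Qed.

Lemma binomp_pascal y m : binomp (y + 1) m.+1 = binomp y m.+1 + binomp y m.
Proof.
have nz : (m.+1%:R : {poly R}) != 0 by rewrite -polyC_natr polyC_eq0 pnatr_eq0.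
apply: (mulfI nz); rewrite mulrDr !binompS.
have := mul_binomp_pred (y + 1) m; rewrite addrK => <-.
by rewrite -natr1; ring.
Qed.

(** Pascal's rule applied twice. For [y = x + j] the remainder sits at [y - 1 = x + (j - 1)] with
    lower index reduced by 2, which is what turns [h_j] into [h_{j-1}]. *)
Lemma binomp_central_diff y m :
  binomp (y + 1) m.+2 + binomp (y - 1) m.+2 = 2 * binomp y m.+2 + binomp (y - 1) m.
Proof.
have e k : binomp y k.+1 = binomp (y - 1) k.+1 + binomp (y - 1) k.
  by rewrite -binomp_pascal subrK.
by rewrite binomp_pascal (e m) (e m.+1); ring.
Qed.

(** Split [2y - m] as [y + (y - m)]; the second part yields a factor [y] by [mul_binomp_pred]. *)
Lemma binomp_central_div y m : y != 0 ->
  (binomp y m * (2 * y - m%:R)) %/ y = binomp y m + binomp (y - 1) m.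
Proof.
move=> nz; rewrite -[RHS](mulpK _ nz) [in RHS]mulrDl [binomp (y - 1) m * y]mulrC.
by rewrite mul_binomp_pred; congr (_ %/ _); ring.
Qed.

End Binomp.

(** A truncation of the power series [c], built one coefficient at a time. *)
Lemma poly_sqrt4DX (R : realType) (n : nat) :
  {p : {poly R} | p`_0 = 2 & forall k, (k <= n)%N -> (p * p)`_k = (4%:P + 'X)`_k}.
Proof.
elim: n => [|n [p p0 IH]].
  exists 2%:P => [|k]; first by rewrite coefC.
  rewrite leqn0 => /eqP ->; rewrite -polyCM coefD !coefC coefX eqxx /=.
  by rewrite addr0 -natrM.
(* Adding [a *: 'X^(n.+1)] to [p] keeps the lower coefficients of the square and raises the next one
   by [2 * a * p_0 = 4 * a]. *)
pose a := ((4%:P + 'X)`_n.+1 - (p * p)`_n.+1) / 4 : R.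
exists (p + a *: 'X^(n.+1)) => [|k lek].
  by rewrite coefD coefZ coefXn mulr0 addr0.
have sqrD (c : R) (x : {poly R}) :
    (p + c *: x) * (p + c *: x) = p * p + ((2 * c) *: p + c ^+ 2 *: x) * x.
  by rewrite -!mul_polyC polyCM polyC_natr polyC_exp; ring.
rewrite sqrD [LHS]coefD coefMXn; case: ltnP => [ltk|gek]; first by rewrite addr0 IH.
have -> : k = n.+1 by apply/eqP; rewrite eqn_leq lek.
rewrite subnn [X in _ + X]coefD !coefZ coefXn mulr0 addr0 p0 /a.
by field.
Qed.

Section HalfShift.
Variable R : realType.
Implicit Types f g : {poly R}.

Definition half_shift_sum f : {poly R} :=
  (f \Po ('X + (2^-1)%:P)) + (f \Po ('X - (2^-1)%:P)).

Lemma polyC_half_double : (2^-1)%:P + (2^-1)%:P = 1 :> {poly R}.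
Proof. by rewrite -polyCD; congr polyC; field. Qed.

Lemma comp_poly_shift f g c : (f \Po ('X + c%:P)) \Po g = f \Po (g + c%:P).
Proof. by rewrite -comp_polyA comp_polyD comp_polyX comp_polyC. Qed.

Lemma comp_poly_shiftN f g c : (f \Po ('X - c%:P)) \Po g = f \Po (g - c%:P).
Proof. by rewrite -polyCN comp_poly_shift. Qed.

Lemma half_shift_sum_is_linear : linear half_shift_sum.
Proof.
by move=> a f g; rewrite /half_shift_sum !comp_polyD !comp_polyZ scalerDr addrACA.
Qed.

HB.instance Definition _ := GRing.isLinear.Build R {poly R} {poly R} _
  half_shift_sum half_shift_sum_is_linear.

Lemma half_shift_sum_sqr f :
  half_shift_sum (half_shift_sum f) = (f \Po ('X + 1)) + (f \Po ('X - 1)) + 2 * f.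
Proof.
rewrite /half_shift_sum 2!comp_polyD 2!comp_poly_shift 2!comp_poly_shiftN.
rewrite addrK subrK -[_ + _ + _%:P]addrA -[_ - _ - _]addrA -opprD polyC_half_double.
by rewrite comp_polyXr; ring.
Qed.

Lemma half_shift_sum_eqN2 f : half_shift_sum f = - (2 * f) -> f = 0.
Proof.
(* A shift preserves both degree and leading coefficient. *)
have lead (c : R) : (f \Po ('X + c%:P))`_(size f).-1 = lead_coef f.
  have s2 : size ('X + c%:P) = 2%N by rewrite size_XaddC.
  rewrite -[(size f).-1](congr1 predn (size_comp_poly2 f s2)) -lead_coefE.
  by rewrite lead_coef_comp ?s2 // lead_coefXaddC expr1n mulr1.
move=> /(congr1 (fun g : {poly R} => g`_(size f).-1)).
rewrite /half_shift_sum -polyCN coefD !lead -polyC_natr coefN coefCM -lead_coefE.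
move=> /eqP; rewrite -subr_eq0 opprK => /eqP e.
have {e} : 4 * lead_coef f = 0 by rewrite -e; ring.
by move=> /eqP; rewrite mulf_eq0 pnatr_eq0 lead_coef_eq0 => /eqP.
Qed.

(* The error [e_j = T h_j - \sum_k c_k h_{j-k}] satisfies
   [T e_j = - \sum_k c_k e_{j-k}], which by induction is [- 2 e_j]; but
   [T + 2] multiplies leading coefficients by 4. *)
Lemma half_shift_sum_conv (h : nat -> {poly R}) (p : {poly R}) (n : nat) :
  p`_0 = 2 -> (forall k, (k <= n)%N -> (p * p)`_k = (4%:P + 'X)`_k) ->
  (forall j, (h j \Po ('X + 1)) + (h j \Po ('X - 1)) =
             2 * h j + (if j is j'.+1 then h j' else 0)) ->
  forall j, (j <= n)%N -> half_shift_sum (h j) = \sum_(k < j.+1) p`_k *: h (j - k)%N.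
Proof.
move=> p0 pp dh.
(* In a second variable [t], with coefficients in [{poly R}], the convolution is a coefficient of
   [P * Q]. Up to degree [n], [P * P] is [4 + t], and multiplication by [t] shifts the index of
   [h]. *)
pose P := map_poly polyC p.
pose Q := \poly_(j < n.+1) h j.
have PQ j : (j <= n)%N -> \sum_(k < j.+1) p`_k *: h (j - k)%N = (P * Q)`_j.
  move=> lejn; rewrite coefM; apply: eq_bigr => k _.
  by rewrite coef_map coef_poly ltnS (leq_trans (leq_subr _ _) lejn) mul_polyC.
have PPQ j : (j <= n)%N -> (P * (P * Q))`_j = half_shift_sum (half_shift_sum (h j)).
  move=> lejn; rewrite half_shift_sum_sqr dh mulrA -rmorphM /=.
  transitivity ((map_poly polyC (4%:P + 'X) * Q)`_j).
    rewrite !coefM; apply: eq_bigr => k _; rewrite !coef_map pp //.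
    by rewrite (leq_trans _ lejn) // -ltnS.
  rewrite rmorphD /= map_polyC map_polyX mulrDl coefD coefCM coefXM !coef_poly.
  rewrite ltnS lejn; case: j lejn => [|j] lejn /=; first by rewrite polyC_natr; ring.
  by rewrite ltnW // polyC_natr; ring.
elim/ltn_ind=> j IH lejn; rewrite PQ //.
apply/eqP; rewrite -subr_eq0; apply/eqP/half_shift_sum_eqN2.
rewrite linearB /= -PPQ // -PQ // linear_sum /= [in X in X - _]coefM.
rewrite -sumrB big_ord_recl big1 => [|k _] /=.
  rewrite coef_map p0 subn0 linearZ /= PQ // polyC_natr -mul_polyC polyC_natr.
  by ring.
have ltj : (j - bump 0 k < j)%N.
  by rewrite ltn_subrL /= (leq_ltn_trans (leq0n k) (ltn_ord k)).
have lej : (j - bump 0 k <= n)%N by rewrite (leq_trans (leq_subr _ _) lejn).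
by rewrite linearZ /= IH // PQ // coef_map mul_polyC subrr.
Qed.

End HalfShift.

Arguments half_shift_sum {R} f.

Section Columns.
Variables (R : realType) (b : R).

Definition Hcol (j : nat) : {poly R} :=
  binomp ('X + j%:R) (2 * j)%N + b *: binomp ('X + j%:R) (2 * j + 1)%N.

Lemma Hcol_comp j (q : {poly R}) :
  Hcol j \Po q = binomp (q + j%:R) (2 * j)%N + b *: binomp (q + j%:R) (2 * j + 1)%N.
Proof.
by rewrite /Hcol comp_polyD binomp_comp comp_polyZ binomp_comp comp_polyD comp_polyX rmorph_nat.
Qed.

Lemma Hcol_central_diff j : (Hcol j \Po ('X + 1)) + (Hcol j \Po ('X - 1)) =
  2 * Hcol j + (if j is j'.+1 then Hcol j' else 0).
Proof.
rewrite !Hcol_comp /Hcol; case: j => [|j].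
  (* [h_0 = 1 + b x] is affine, so its second difference vanishes. *)
  rewrite !muln0 !binomp0 !addr0 add0n /binomp !big_ord1 invr1 !scale1r !subr0.
  by rewrite -!mul_polyC; ring.
rewrite addrACA -(scalerDr b) mulnS add2n addSn addSn.
rewrite ![_ + 1 + _]addrAC ![_ - 1 + _]addrAC !binomp_central_diff.
have -> : 'X + j.+1%:R - 1 = 'X + j%:R :> {poly R} by rewrite -natr1 addrA addrK.
by rewrite -!(mul_polyC b); ring.
Qed.

Lemma Ventry_half_shift i j :
  Ventry b i j = half_shift_sum (Hcol j) \Po ('X + i%:R - (2^-1)%:P).
Proof.
have nz : 'X + i%:R + j%:R != 0 :> {poly R}.
  by rewrite -addrA -natrD -polyC_natr -[_%:R]opprK polyCN polyXsubC_eq0.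
rewrite /half_shift_sum comp_polyD comp_poly_shift comp_poly_shiftN.
rewrite subrK -[_ - _ - _]addrA -opprD.
rewrite polyC_half_double !Hcol_comp [in RHS]addrACA -(scalerDr b).
rewrite /Ventry /Vnum_even /Vnum_odd [_ - 1 + j%:R]addrAC.
(* With [y = x + i + j], the numerators [2x + 2i] and [2x + 2i - 1] are [2y - 2j] and
   [2y - (2j + 1)]. *)
rewrite -!binomp_central_div //; congr (_ * _ %/ _ + _ *: (_ * _ %/ _)).
  by rewrite natrM; ring.
by rewrite natrD natrM; ring.
Qed.

End Columns.

Arguments Hcol {R} b j.

Theorem theorem9 (R : realType) (b : R) (n : nat) :
  V n b = \det (\matrix_(i < n, j < n) Ventry b i j).
Proof.
have [p p0 pp] := poly_sqrt4DX R n.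
pose q : {poly R} := 'X - (2^-1)%:P.
pose M := \matrix_(i < n, j < n) (Hcol b j \Po (q + i%:R)).
pose C := \matrix_(k < n, j < n) (if (k <= j)%N then (p`_(j - k))%:P else 0).
have -> : \matrix_(i < n, j < n) Ventry b i j = M *m C.
  apply/matrixP=> i j; rewrite !mxE Ventry_half_shift.
  rewrite (half_shift_sum_conv _ _ _ _ p0 pp (Hcol_central_diff R b)) 1?ltnW //.
  (* Reversal makes the index of [Hcol] the summation variable; widening the range to [n] adds the
     zeros of [C] below the diagonal. *)
  rewrite linear_sum /= (reindex_inj rev_ord_inj) /=.
  rewrite (big_ord_widen n (fun k => (p`_(j.+1 - k.+1) *: Hcol b (j - (j.+1 - k.+1)))
     \Po ('X + i%:R - (2^-1)%:P))) // big_mkcond /=; apply: eq_bigr => k _.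
  rewrite !mxE ltnS; case: ifP => [lekj|_]; last by rewrite mulr0.
  by rewrite subSS subKn // comp_polyZ -mul_polyC mulrC addrAC.
rewrite det_mulmx mulrC /V; congr (_ * _).
  (* [det_trig] concerns lower triangular matrices, hence the transpose. *)
  rewrite -det_tr det_trig; last first.
    by apply/is_trig_mxP=> i j ltij; rewrite !mxE leqNgt ltij.
  rewrite (eq_bigr (fun=> 2)) => [|i _]; first by rewrite prodr_const card_ord.
  by rewrite !mxE leqnn subnn p0 polyC_natr.
have -> : 2^-1 *: (2 * 'X - 1) = q.
  rewrite /q scalerBr -polyC_natr -mul_polyC mulrA -polyCM mulVf ?pnatr_eq0 //.
  by rewrite mul1r -alg_polyC.
rewrite /H -det_map_mx; congr (\det _); apply/matrixP=> i j; rewrite !mxE Hcol_comp.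
by rewrite /= comp_polyD binomp_comp comp_polyZ binomp_comp !comp_polyD comp_polyX !rmorph_nat.
Qed.
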